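(* Let $c^n_k$, $n\ge k\ge 0$, be a given set of complex numbers, and let $\circ$ be the bracket product with these coefficients. The square relations $$\Phi_Q\circ\Phi_Q=\Phi_{[Q,Q]}$$ are satisfied for all derived $\bullet$-brackets $\Phi_Q$ (i.e. for all $\epsilon\in\{0,1\}$, all graded Lie algebras $(\mathcal{A},[\cdot,\cdot])$ of parity $\epsilon$ and all $Q\in\mathcal{A}$ with $\epsilon(Q)=1-\epsilon$, without assuming $[Q,Q]=0$) if and only if $$c^n_k=B_k+\delta_{k,1}+c^{n(H)}_k,\qquad n\ge k\ge0,$$ where the homogeneous part $c^{n(H)}_k$ is a set of coefficients whose bracket product solves the homogeneous equation $\Phi_Q\circ\Phi_Q=0$ for all derived $\bullet$-brackets $\Phi_Q$ (again without assuming $[Q,Q]=0$). For given $n\in\{0,1,2,\dots\}$, the solution space of the homogeneous problem (the set of tuples $(c^{n}_k)_{0\le k\le n}$ for which $(\Phi_Q\circ\Phi_Q)^n=0$ for all derived $\bullet$-brackets $\Phi_Q$) has dimension $\left[\frac{n+1}{2}\right]$, where $[\cdot]$ denotes the integer part (floor). A basis $c^{n(H)}_{k(m)}$ of solutions, labelled by integers $m\in\{0,1,\dots,[\frac{n-1}{2}]\}$, is $$c^{n(H)}_{k(m)}=\binom{k}{m}B_{k-m}-\binom{k}{n-m}B_{k-n+m},\qquad 0\le k\le n.$$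
   Context: Vector spaces are $\mathbb{Z}_2$-graded over $\mathbb{C}$; $\epsilon_a=\epsilon(a)$ is the Grassmann parity (mod 2). A graded Lie algebra of parity $\epsilon\in\{0,1\}$ is a graded vector space $\mathcal{A}$ with a bilinear bracket satisfying $\epsilon([a,b])=\epsilon_a+\epsilon_b+\epsilon$, $[b,a]=-(-1)^{(\epsilon_a+\epsilon)(\epsilon_b+\epsilon)}[a,b]$, and the Jacobi identity $\sum_{a,b,c\text{ cycl.}}(-1)^{(\epsilon_a+\epsilon)(\epsilon_c+\epsilon)}[[a,b],c]=0$. Sign $(-1)^{\epsilon_{\pi,a}}$: let $\mathrm{Sym}^n_\epsilon\mathcal{A}$ be the quotient of $\mathcal{A}^{\otimes n}$ in which neighbouring factors commute as $b\odot a=(-1)^{(\epsilon_a+\epsilon)(\epsilon_b+\epsilon)}a\odot b$. Then $(-1)^{\epsilon_{\pi,a}}$ is defined by $a_{\pi(1)}\odot\dots\odot a_{\pi(n)}=(-1)^{\epsilon_{\pi,a}}a_1\odot\dots\odot a_n$. For $Q\in\mathcal{A}$ homogeneous (of any parity), the derived $\bullet$-bracket $\Phi_Q=(\Phi_Q^n)_{n\ge0}$ is $$\Phi_Q^n(a_1,\dots,a_n)=\frac1{n!}\sum_{\pi\in S_n}(-1)^{\epsilon_{\pi,a}}[[\dots[Q,a_{\pi(1)}],\dots],a_{\pi(n)}],\qquad \Phi_Q^0=Q.$$ The bracket product with coefficients $c^n_k$ of two $\bullet$-brackets (collections of linear maps $\Phi^n:\mathrm{Sym}^n_\epsilon\mathcal{A}\to\mathcal{A}$,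 $n\ge0$) is $$(\Phi\circ\Phi')^n(a_1,\dots,a_n)=\sum_{k=0}^n\frac{c^n_k}{k!(n-k)!}\sum_{\pi\in S_n}(-1)^{\epsilon_{\pi,a}}\Phi^{n-k+1}\big(\Phi'^k(a_{\pi(1)},\dots,a_{\pi(k)}),a_{\pi(k+1)},\dots,a_{\pi(n)}\big),\quad n\ge0.$$ Bernoulli numbers: $\frac{x}{e^x-1}=\sum_{k\ge0}\frac{B_k}{k!}x^k$ (so $B_1=-\tfrac12$), and $B_{-1}=B_{-2}=\dots=0$. $\delta_{k,1}$ is the Kronecker delta. *)

(* Defs.v *)
From HB Require Import structures.
From mathcomp Require Import all_boot all_order all_algebra all_fingroup zify.
From mathcomp Require Export complex.
From mathcomp Require Export reals.

Set Implicit Arguments.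
Unset Strict Implicit.
Unset Printing Implicit Defensive.

Import Order.TTheory GRing.Theory.

Local Open Scope ring_scope.

(* Elements of Z/2 (parities) are booleans: false is 0, true
   is 1, and (+) is the sum.  Below, F is the field of scalars; the theorem
   takes F := R[i] for a realType R, i.e. the field of complex numbers. *)

(* A grading A = A_0 (+) A_1 is given by the projections gproj p : A -> A onto
   its summands along each other. *)
Record gradedVect (F : fieldType) := GradedVect {
  gv_sort :> lmodType F;
  gproj : bool -> {linear gv_sort -> gv_sort};
  gproj_idem : forall p q (x : gv_sort),
    gproj p (gproj q x) = if p == q then gproj p x else 0;
  gproj_sum : forall x : gv_sort, gproj false x + gproj true x = x
}.

Definition homog (F : fieldType) (A : gradedVect F) (p : bool) (x : A) : Prop :=
  gproj A p x = x.

Record gradedLie (F : fieldType) (eps : bool) := GradedLie {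
  gl_vect :> gradedVect F;
  brac : {bilinear gl_vect -> gl_vect -> gl_vect};
  brac_homog : forall p q (a b : gl_vect), homog p a -> homog q b ->
    homog (p (+) q (+) eps) (brac a b);
  brac_anti : forall p q (a b : gl_vect), homog p a -> homog q b ->
    brac b a = - ((-1) ^+ ((p (+) eps) && (q (+) eps)) *: brac a b);
  brac_jacobi : forall p q r (a b c : gl_vect),
    homog p a -> homog q b -> homog r c ->
      (-1) ^+ ((p (+) eps) && (r (+) eps)) *: brac (brac a b) c
    + (-1) ^+ ((q (+) eps) && (p (+) eps)) *: brac (brac b c) a
    + (-1) ^+ ((r (+) eps) && (q (+) eps)) *: brac (brac c a) b = 0
}.

(* The exponent eps_{s,a} (mod 2) of the sign in
     a_{s(1)} . ... . a_{s(n)} = (-1)^{eps_{s,a}} a_1 . ... . a_n,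
   for a_i of parity p i: every inversion of s contributes one commutation.
   koszul1 and koszul_swap below show that this is the sign coming from the
   relations b . a = (-1)^{(eps_a + eps)(eps_b + eps)} a . b between
   neighbours. *)
Definition koszul (eps : bool) (n : nat) (p : 'I_n -> bool) (s : 'S_n) : bool :=
  \big[addb/false]_(i < n) \big[addb/false]_(j < n | (i < j)%N && (s j < s i)%N)
    ((p (s i) (+) eps) && (p (s j) (+) eps)).

Lemma koszul1 eps n (p : 'I_n -> bool) : koszul eps p 1%g = false.
Proof.
rewrite /koszul big1 // => i _; rewrite big1 // => j /andP[ltij].
by rewrite !perm1 ltnNge (ltnW ltij).
Qed.

(* (tperm i j * s) x = s (tperm i j x): the i-th and j-th factors of the word
   a_{s(1)} . ... . a_{s(n)} are exchanged. *)
Lemma koszul_swap eps n (p : 'I_n -> bool) (s : 'S_n) (i j : 'I_n) :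
  j = i.+1 :> nat ->
  koszul eps p (tperm i j * s)%g =
  koszul eps p s (+) ((p (s i) (+) eps) && (p (s j) (+) eps)).
Proof.
move=> ji; pose w x := p (s x) (+) eps.
have ltij : (i < j)%N by rewrite ji.
have neij : i != j by rewrite -val_eqE ltn_eqF.
rewrite /koszul !pair_big_dep /=.
rewrite (reindex (fun q : 'I_n * 'I_n => (tperm i j q.1, tperm i j q.2))) /=;
  last by exists (fun q : 'I_n * 'I_n => (tperm i j q.1, tperm i j q.2));
    move=> [x y] _ /=; rewrite !tpermK.
under eq_bigl => q do rewrite !permM !tpermK.
under eq_bigr => q _ do rewrite !permM !tpermK.
rewrite [LHS]big_mkcond [in RHS]big_mkcond /=.
rewrite (bigD1 (i, j)) //= (bigD1 (j, i)) /=; last first.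
  by rewrite xpair_eqE negb_and eq_sym neij.
rewrite [in RHS](bigD1 (i, j)) //= [in RHS](bigD1 (j, i)) /=; last first.
  by rewrite xpair_eqE negb_and eq_sym neij.
rewrite tpermL tpermR ltij ltnNge (ltnW ltij) /=.
set X := \big[_/_]_(_ | _) _; set Y := \big[_/_]_(_ | _) _.
have -> : X = Y.
  apply: eq_bigr => -[x y] /= /andP[xyij xyji]; congr (if _ && _ then _ else _).
  move: xyij xyji; rewrite !xpair_eqE -!val_eqE /=.
  case: tpermP => [->|->|/eqP xi /eqP xj];
    case: tpermP => [->|->|/eqP yi /eqP yj];
    try (move: xi xj; rewrite -!val_eqE /= => xi xj);
    try (move: yi yj; rewrite -!val_eqE /= => yi yj); lia.
have -> : (s i < s j)%N = ~~ (s j < s i)%N.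
  by rewrite -leqNgt ltn_neqAle val_eqE (inj_eq perm_inj) neij.
by case: (s j < s i)%N; case: (p (s i)); case: (p (s j)); case: (eps); case: Y.
Qed.

(* A bullet-bracket: the family of its components Phi^n, as maps of n-tuples. *)
Definition bullet (T : Type) := forall n : nat, n.-tuple T -> T.

(* The formulas for brackets are given on homogeneous arguments and extended
   multilinearly: each argument is split into its homogeneous components, and
   p runs over the choices of a component for each argument. *)
Definition derived (F : fieldType) (eps : bool) (A : gradedLie F eps) (Q : A) :
    bullet A := fun n a =>
  n`!%:R^-1 *: \sum_(p : {ffun 'I_n -> bool}) \sum_(s : 'S_n)
    (-1) ^+ koszul eps p s *:
      foldl (brac A) Q [tuple gproj A (p (s i)) (tnth a (s i)) | i < n].

Lemma derivedE (F : fieldType) (eps : bool) (A : gradedLie F eps) (Q : A)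
    (n : nat) (p : {ffun 'I_n -> bool}) (a : n.-tuple A) :
    (forall i, homog (p i) (tnth a i)) ->
  derived Q a = n`!%:R^-1 *: \sum_(s : 'S_n)
    (-1) ^+ koszul eps p s *: foldl (brac A) Q [tuple tnth a (s i) | i < n].
Proof.
move=> ap; rewrite /derived; congr (_ *: _).
have foldl0 (t : seq A) : foldl (brac A) 0 t = 0.
  by elim: t => //= x t IH; rewrite linear0l.
have foldl_mem0 (t : seq A) : 0 \in t -> forall x, foldl (brac A) x t = 0.
  elim: t => //= y t IH; rewrite inE => /orP[/eqP <- x|/IH h x //].
  by rewrite linear0r foldl0.
rewrite (bigD1 p) //= [X in _ + X]big1 ?addr0 => [|q neqp].
  apply: eq_bigr => s _; congr (_ *: foldl _ _ _).
  by apply: eq_map => i; rewrite ap.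
rewrite big1 // => s _; rewrite foldl_mem0 ?scaler0 //.
have /existsP[i qpi] : [exists i, q i != p i].
  by rewrite -negb_forall; apply: contra neqp => /forallP qp;
     apply/eqP/ffunP => i; apply/eqP.
apply/mapP; exists (s^-1 i)%g; first by rewrite mem_enum.
by rewrite permKV -ap gproj_idem (negbTE qpi).
Qed.

(* The n-th component of the bracket product with coefficients c^n_0..c^n_n. *)
Definition bprod_n (F : fieldType) (eps : bool) (A : gradedVect F)
    (n : nat) (c : 'rV[F]_n.+1) (Phi Phi' : bullet A) (a : n.-tuple A) : A :=
  \sum_(k < n.+1) (c 0 k / (k`!%:R * (n - k)`!%:R)) *:
    \sum_(p : {ffun 'I_n -> bool}) \sum_(s : 'S_n) (-1) ^+ koszul eps p s *:
      let b := [tuple gproj A (p (s i)) (tnth a (s i)) | i < n] in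
      Phi (n - k).+1
        [tuple of Phi' k [tuple b`_i | i < k] :: [tuple b`_(k + j)%N | j < n - k]].

Definition coefs (F : fieldType) := forall n : nat, 'rV[F]_n.+1.

Definition bprod (F : fieldType) (eps : bool) (A : gradedVect F) (c : coefs F)
    (Phi Phi' : bullet A) : bullet A :=
  fun n a => bprod_n eps (c n) Phi Phi' a.

Definition square_relations (F : fieldType) (c : coefs F) : Prop :=
  forall (eps : bool) (A : gradedLie F eps) (Q : A), homog (~~ eps) Q ->
  forall (n : nat) (a : n.-tuple A),
    bprod eps c (derived Q) (derived Q) a = derived (brac A Q Q) a.

Definition homogeneous_relations_n (F : fieldType) (n : nat) (c : 'rV[F]_n.+1) :
    Prop :=
  forall (eps : bool) (A : gradedLie F eps) (Q : A), homog (~~ eps) Q ->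
  forall a : n.-tuple A, bprod_n eps c (derived Q) (derived Q) a = 0.

Definition homogeneous_relations (F : fieldType) (c : coefs F) : Prop :=
  forall (eps : bool) (A : gradedLie F eps) (Q : A), homog (~~ eps) Q ->
  forall (n : nat) (a : n.-tuple A), bprod eps c (derived Q) (derived Q) a = 0.

(* The coefficients b_j = B_j / j! of x / (e^x - 1) for j < n, obtained by
   dividing the formal power series x by e^x - 1 = \sum_(i >= 1) x^i / i!. *)
Fixpoint bernoulli_seq (F : fieldType) (n : nat) : seq F :=
  if n is m.+1 then
    let b := bernoulli_seq F m in
    rcons b ((m == 0)%N%:R - \sum_(j < m) b`_j / (m.+1 - j)`!%:R)
  else [::].

Definition bernoulli_nat (F : fieldType) (k : nat) : F :=
  k`!%:R * (bernoulli_seq F k.+1)`_k.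

Definition bernoulli (F : fieldType) (z : int) : F :=
  match z with Posz k => bernoulli_nat F k | Negz _ => 0 end.

(* (\sum_k B_k / k! x^k) (e^x - 1) = x as formal power series. *)
Lemma bernoulli_genE (F : numFieldType) (n : nat) :
  \sum_(k < n.+1) (bernoulli F k / k`!%:R) *
     (if (n - k == 0)%N then 0 else (n - k)`!%:R^-1) = (n == 1)%N%:R.
Proof.
have fact0 m : m`!%:R != 0 :> F by rewrite Num.Theory.pnatr_eq0 -lt0n fact_gt0.
have sz m : size (bernoulli_seq F m) = m.
  by elim: m => //= m IH; rewrite size_rcons IH.
have nthE m k : (k < m)%N ->
    (bernoulli_seq F m)`_k = (bernoulli_seq F k.+1)`_k.
  elim: m => // m IH; rewrite ltnS leq_eqVlt => /orP[/eqP -> //|ltkm].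
  by rewrite nth_rcons sz ltkm IH.
have bE (k : nat) : bernoulli F k / k`!%:R = (bernoulli_seq F k.+1)`_k.
  by rewrite /= /bernoulli_nat mulrAC mulfV // mul1r.
rewrite big_ord_recr /= subnn eqxx mulr0 addr0.
case: n => [|m]; first by rewrite big_ord0.
under eq_bigr => k _ do rewrite bE subn_eq0 leqNgt ltn_ord /=.
rewrite big_ord_recr /= nth_rcons sz ltnn eqxx subSnn invr1 mulr1.
rewrite [X in X + _](_ : _ = \sum_(k < m) (bernoulli_seq F m)`_k / (m.+1 - k)`!%:R).
  by rewrite addrC subrK.
by apply: eq_bigr => k _; rewrite -/(bernoulli_seq F k.+1) (nthE m k).
Qed.

Definition hom_basis (F : fieldType) (n m : nat) : 'rV[F]_n.+1 :=
  \row_(k < n.+1)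
    ('C(k, m)%:R * bernoulli F (k%:Z - m%:Z)
     - 'C(k, n - m)%:R * bernoulli F (k%:Z - n%:Z + m%:Z)).

(* Main.v *)
From HB Require Import structures.
Require Import Defs.
From mathcomp Require Import all_boot all_order all_algebra all_fingroup zify ring.

Set Implicit Arguments.
Unset Strict Implicit.
Unset Printing Implicit Defensive.

Import GRing.Theory.
Local Open Scope ring_scope.

(* Shifting parities by epsilon makes the bracket even and Q odd.  Since all
   brackets are graded symmetrized over the arguments, these behave like n copies
   of one even element a, and D = [-, a] is a derivation.  With Q_i = D^i Q one has
   [Q_i, Q_j] = [Q_j, Q_i], and the Leibniz rule gives
     (Phi_Q o Phi_Q)^n = \sum_m lam_m(c) n! / (m! (n-m)!) [Q_m, Q_(n-m)],
     lam_m(c) = \sum_(k <= m) c_k 'C(m+1, k) / (m+1),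
     Phi_[Q,Q]^n = \sum_m n! / (m! (n-m)!) [Q_m, Q_(n-m)].
   By the symmetry of the brackets only lam_m + lam_(n-m) matters.  In a
   four-dimensional Lie superalgebra where Q is a sum of two eigenvectors of D
   with eigenvalues alpha and 1, [Q_m, Q_(n-m)] is alpha^m + alpha^(n-m) times a
   fixed vector, so c is a homogeneous solution iff lam_m = - lam_(n-m) for all m.
   The defining recursion of the Bernoulli numbers says that the coordinates
   lam_j are dual to the tuples 'C(k, m) B_(k-m); moreover lam = 1 on
   B_k + delta_(k,1). *)

(** * Signed sums over permutations of a word *)

(** Permutations are sorted by the position [i] that is sent to [ord0]. For words, [i] is the place
    taken by the first letter, so sums over permutations become accessible to induction on the
    number of letters. *)
Lemma sum_lift_perm (V : nmodType) n (F : 'S_n.+1 -> V) :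
  \sum_s F s = \sum_(i < n.+1) \sum_(s : 'S_n) F (lift_perm i ord0 s).
Proof.
rewrite (partition_big (fun s : 'S_n.+1 => (s^-1)%g ord0) xpredT) //=.
apply: eq_bigr => i _; pose f := (lift_perm i ord0).
have injf : injective f.
  move=> s t /permP est; apply/permP => x; apply: (@lift_inj _ ord0).
  by rewrite -!(lift_perm_lift i); apply: est.
(* The inverse of [f] is chosen by [pick]; what remains is that every [s] with [s i = ord0] lies in
   the image of [f]. *)
rewrite (reindex_onto f (fun s => odflt 1%g [pick t | f t == s])) /=.
  apply: eq_bigl => s; case: pickP => [t /eqP/injf ->|/(_ s)]; last by rewrite eqxx.
  by rewrite eqxx andbT; apply/eqP; rewrite -(lift_perm_id i ord0 s) permK.
move=> s /eqP si; case: pickP => [t /eqP //|nof].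
have s0 : s i = ord0 by rewrite -si permKV.
have nes x : s i != s (lift i x) by rewrite (inj_eq perm_inj) neq_lift.
(* [g] is [s] with the position [i] and the value [ord0] deleted; by [nes] the default of [odflt]
   never occurs. *)
pose g x := odflt x (unlift ord0 (s (lift i x))).
have gE x : lift ord0 (g x) = s (lift i x).
  by rewrite /g; case: unliftP (nes x) => [j ->|->] //=; rewrite s0 eqxx.
have injg : injective g.
  by move=> x y /(congr1 (lift ord0)); rewrite !gE => /perm_inj/lift_inj.
have /eqP[] := nof (perm injg); apply/permP => x; rewrite /f.
case: (unliftP i x) => [j ->|->]; last by rewrite lift_perm_id s0.
by rewrite lift_perm_lift permE gE.
Qed.

(** The value [ord0] at position [i] forms an inversion exactly with the positions before [i]; all
    other inversions are those of [s]. *)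
Lemma koszul_lift_perm n (p : 'I_n.+1 -> bool) i (s : 'S_n) :
  koszul false p (lift_perm i ord0 s) =
    (p ord0 && \big[addb/false]_(x < n | (x < i)%N) p (lift ord0 (s x)))
    (+) koszul false (p \o lift ord0) s.
Proof.
rewrite /koszul (bigD1_ord i) //= big1 ?addFb => [|j]; last first.
  by rewrite lift_perm_id andbC.
rewrite big_distrr /= [X in _ = X (+) _]big_mkcond -big_split /=.
apply: eq_bigr => x _.
rewrite big_mkcond (bigD1_ord i) //= lift_perm_lift lift_perm_id !addbF /=.
congr (_ (+) _).
  rewrite andbT /=; have -> : (bump i x < i)%N = (x < i)%N by rewrite /bump; lia.
  by case: ifP => _ //; rewrite andbC.
rewrite [RHS]big_mkcond; apply: eq_bigr => y _.
rewrite !lift_perm_lift /= !addbF !/bump /=.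
have -> : ((i <= x) + x < (i <= y) + y)%N = (x < y)%N by lia.
by rewrite !add1n ltnS.
Qed.

Section SignedSums.
Variables (R : comNzRingType) (T : eqType) (w : T -> bool) (V : lmodType R).
Implicit Types (f g : seq T -> V).

Definition wpar (u : seq T) : bool := \big[addb/false]_(x <- u) w x.

Lemma wpar_cons a u : wpar (a :: u) = w a (+) wpar u.
Proof. exact: big_cons. Qed.

Lemma wpar_nil : wpar [::] = false.
Proof. exact: big_nil. Qed.

Lemma wpar_cat u v : wpar (u ++ v) = wpar u (+) wpar v.
Proof. exact: big_cat. Qed.

Lemma wpar_perm u v : perm_eq u v -> wpar u = wpar v.
Proof. exact: perm_big. Qed.

(** The weights [w] stand for parities already shifted by epsilon, hence [koszul false]. Since [f]
    takes lists, words can be cut and joined without casts between tuple types. *)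
Definition ssum n (t : n.-tuple T) f : V :=
  \sum_(s : 'S_n) (-1) ^+ koszul false (w \o tnth t) s *:
    f [seq tnth t (s i) | i <- enum 'I_n].

(** The sign is that of moving [a] from the front of the word past [take i u]. *)
Definition insert_sum a u f : V :=
  \sum_(i < (size u).+1) (-1) ^+ (w a && wpar (take i u)) *:
    f (take i u ++ a :: drop i u).

(* [f] extended linearly and applied to the graded shuffle product of the
   letters of [l]. *)
Fixpoint shuffle_sum (l : seq T) f : V :=
  if l is a :: l' then shuffle_sum l' (fun u => insert_sum a u f) else f [::].

Lemma nth_word n (F : 'I_n -> T) x0 (j : 'I_n) :
  nth x0 [seq F i | i <- enum 'I_n] j = F j.
Proof. by rewrite (nth_map j) ?size_enum_ord // nth_ord_enum. Qed.

Lemma perm_word n (t : n.-tuple T) (s : 'S_n) :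
  perm_eq [seq tnth t (s i) | i <- enum 'I_n] t.
Proof.
apply/tuple_permP; exists s => /=.
by rewrite -val_ord_tuple.
Qed.

Lemma wpar_word n (F : 'I_n -> T) i : (i <= n)%N ->
  wpar (take i [seq F x | x <- enum 'I_n]) =
    \big[addb/false]_(x < n | (x < i)%N) w (F x).
Proof.
case: n F => [|n] F lein.
  by rewrite (size0nil (size_enum_ord 0)) big_ord0 wpar_nil.
rewrite /wpar (big_nth (F ord0)) size_take size_map size_enum_ord.
rewrite (_ : (if _ then _ else _) = i) ?big_mkord; last by case: ltngtP lein.
rewrite (big_ord_widen n.+1 (fun j => w (nth (F ord0) (take i _) j))) //.
by apply: eq_bigr => x ltxi; rewrite nth_take // nth_word.
Qed.

Lemma word_lift_perm n a (l : n.-tuple T) i (s : 'S_n) :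
  let u := [seq tnth l (s x) | x <- enum 'I_n] in
  [seq tnth [tuple of a :: l] (lift_perm i ord0 s x) | x <- enum 'I_n.+1] =
    take i u ++ a :: drop i u.
Proof.
move=> u; have su : size u = n by rewrite size_map size_enum_ord.
have lin : (i <= n)%N by rewrite -ltnS.
have st : size (take i u) = i by rewrite size_takel ?su.
apply: (@eq_from_nth _ a) => [|j].
  by rewrite size_map size_enum_ord size_cat /= size_drop st su; lia.
rewrite size_map size_enum_ord => ltj; rewrite -[j]/(val (Ordinal ltj)) nth_word.
case: (unliftP i (Ordinal ltj)) => [k|] ->.
  rewrite lift_perm_lift tnthS nth_cat st /= /bump.
  case: (leqP i k) => [leik|ltki] /=; last first.
    by rewrite ltki nth_take // nth_word.
  rewrite add1n ltnNge (leqW leik) /= subSn //= nth_drop subnKC //.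
  by rewrite nth_word.
by rewrite lift_perm_id nth_cat st ltnn subnn tnth0.
Qed.

(** Recursion on the first letter: by [sum_lift_perm] it is inserted at each place of a permuted
    word of the others, and [koszul_lift_perm] supplies the sign of the insertion. *)
Lemma ssumE n (t : n.-tuple T) f : ssum t f = shuffle_sum t f.
Proof.
elim: n t f => [|n IHn] t f.
  rewrite tuple0 /ssum /= (bigD1 1%g) //= big1 => [|s]; last first.
    by case/negP; apply/eqP/permP => -[].
  by rewrite koszul1 scale1r addr0 (size0nil (size_enum_ord 0)).
case: t / tupleP => a l /=; rewrite -IHn /ssum sum_lift_perm exchange_big /=.
apply: eq_bigr => s _; set u := [seq _ | _ <- _].
have su : size u = n by rewrite size_map size_enum_ord.
rewrite /insert_sum su scaler_sumr; apply: eq_bigr => i _.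
rewrite word_lift_perm -/u scalerA -signr_addb; congr ((-1) ^+ _ *: _).
rewrite koszul_lift_perm addbC; congr (_ (+) _).
  by rewrite /koszul; do 2![apply: eq_bigr => ? _]; rewrite /= !tnthS.
rewrite /= tnth0 wpar_word -1?ltnS //; congr (_ && _).
by apply: eq_bigr => x _; rewrite tnthS.
Qed.

Lemma eq_ssum n (t : n.-tuple T) f g :
  (forall u, perm_eq u t -> f u = g u) -> ssum t f = ssum t g.
Proof. by move=> fg; apply: eq_bigr => s _; rewrite fg ?perm_word. Qed.

Lemma eq_shuffle_sum (l : seq T) f g :
  (forall u, perm_eq u l -> f u = g u) -> shuffle_sum l f = shuffle_sum l g.
Proof.
move=> fg; rewrite -(ssumE (in_tuple l) f) -(ssumE (in_tuple l) g).
exact: eq_ssum.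
Qed.

Lemma ssum_sum n (t : n.-tuple T) I (r : seq I) (P : pred I) (h : I -> seq T -> V) :
  ssum t (fun u => \sum_(i <- r | P i) h i u) = \sum_(i <- r | P i) ssum t (h i).
Proof.
rewrite /ssum exchange_big /=; apply: eq_bigr => s _.
by rewrite scaler_sumr.
Qed.

Lemma ssumD n (t : n.-tuple T) f g :
  ssum t (fun u => f u + g u) = ssum t f + ssum t g.
Proof. by rewrite /ssum -big_split; apply: eq_bigr => s _; rewrite scalerDr. Qed.

Lemma ssumZ n (t : n.-tuple T) c f :
  ssum t (fun u => c *: f u) = c *: ssum t f.
Proof.
rewrite /ssum scaler_sumr; apply: eq_bigr => s _.
by rewrite !scalerA mulrC.
Qed.

Lemma cat_sizeP (y : seq T) i n : size y = (i + n)%N ->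
  {uv : seq T * seq T | [/\ y = uv.1 ++ uv.2, size uv.1 = i & size uv.2 = n]}.
Proof.
move=> szy; exists (take i y, drop i y) => /=.
by rewrite cat_take_drop size_takel ?size_drop ?szy ?addKn ?leq_addr.
Qed.

(** The sum is reindexed by a transposition of neighbouring positions, whose effect on the Koszul
    sign is [koszul_swap]. This and the next two lemmas let letters be moved inside a signed sum at
    the price of their sign. *)
Lemma ssum_swap n (t : n.-tuple T) i m f g : n = (i + m.+2)%N ->
  (forall u a b v, size u = i -> size v = m ->
     g (u ++ a :: b :: v) = (-1) ^+ (w a && w b) *: f (u ++ b :: a :: v)) ->
  ssum t g = ssum t f.
Proof.
move=> En fg.
have lti : (i < n)%N by lia.
have ltj : (i.+1 < n)%N by lia.
pose i1 := Ordinal lti; pose j1 := Ordinal ltj.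
rewrite [RHS](reindex_inj (mulgI (tperm i1 j1))) /=; apply: eq_bigr => s _.
rewrite koszul_swap //= signr_addb -scalerA !addbF; congr (_ *: _).
pose x0 := tnth t i1.
set y := [seq tnth t (s _) | _ <- _].
have sz : size y = (i + m.+2)%N by rewrite size_map size_enum_ord En.
have [[u z] /= [Ey szu]] := cat_sizeP sz.
case: z Ey => [//|a [//|b v]] Ey [szv].
have nthy (k : 'I_n) : nth x0 y k = tnth t (s k) by rewrite nth_word.
have Ea : a = tnth t (s i1) by rewrite -nthy Ey nth_cat szu /= ltnn subnn.
have Eb : b = tnth t (s j1).
  by rewrite -nthy Ey nth_cat szu /= ltnNge leqnSn subSnn.
rewrite Ey fg // -Ea -Eb; congr (_ *: f _).
apply: (@eq_from_nth _ x0) => [|k].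
  by rewrite size_map size_enum_ord size_cat /= szu szv En.
rewrite size_cat /= szu szv -En => ltk.
rewrite -[k]/(val (Ordinal ltk)) nth_word permM.
case: tpermP => [->|->|/eqP ni /eqP nj].
- by rewrite -Eb nth_cat szu /= ltnn subnn.
- by rewrite -Ea nth_cat szu /= ltnNge leqnSn subSnn.
rewrite -nthy Ey !nth_cat szu /=; case: ltnP => // leik.
move: ni nj; rewrite -!val_eqE /= => ni nj.
by have -> : (k - i = (k - i - 2).+2)%N by lia.
Qed.

Lemma ssum_letter n (t : n.-tuple T) i k m f g : n = (i + (k + m).+1)%N ->
  (forall u a v x, size u = i -> size v = k -> size x = m ->
     g (u ++ a :: v ++ x) = (-1) ^+ (w a && wpar v) *: f (u ++ v ++ a :: x)) ->
  ssum t g = ssum t f.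
Proof.
elim: k i g => [|k IHk] i g En fg.
  apply: eq_ssum => y /perm_size; rewrite size_tuple En => szy.
  have [[u z] /= [-> szu]] := cat_sizeP szy; case: z => //= a x [szx].
  by rewrite (fg u a [::] x) // wpar_nil andbF scale1r.
(* Once [a] has been exchanged with its right neighbour, [h] moves it past the [k] letters that
   follow. The value 0 is never taken on words of length [n]. *)
pose h y := if drop i.+1 y is a :: z then
  (-1) ^+ (w a && wpar (take k z)) *: f (take i.+1 y ++ take k z ++ a :: drop k z)
  else 0.
have hE u a v x : size u = i.+1 -> size v = k -> size x = m ->
    h (u ++ a :: v ++ x) = (-1) ^+ (w a && wpar v) *: f (u ++ v ++ a :: x).
  by move=> su sv sx; rewrite /h drop_size_cat // !take_size_cat // drop_size_cat.
transitivity (ssum t h); last by apply: (IHk i.+1) => //; rewrite En; lia.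
apply: (@ssum_swap _ _ i (k + m)) => [|u a b y su]; first by rewrite En; lia.
move=> szy; have [[v x] /= [-> sv sx]] := cat_sizeP szy.
rewrite (fg u a (b :: v) x) //= ?sv //.
rewrite -(cat_rcons b u (a :: v ++ x)) hE ?size_rcons ?su //.
by rewrite scalerA -signr_addb cat_rcons wpar_cons -andb_addr.
Qed.

(** The block is moved letter by letter: the induction hypothesis carries its tail past the second
    block, then [ssum_letter] carries its first letter. *)
Lemma ssum_block n (t : n.-tuple T) i j k m f g : n = (i + (j + (k + m)))%N ->
  (forall u v v' x, size u = i -> size v = j -> size v' = k -> size x = m ->
     g (u ++ v ++ v' ++ x) = (-1) ^+ (wpar v && wpar v') *: f (u ++ v' ++ v ++ x)) ->
  ssum t g = ssum t f.
Proof.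
elim: j i f g => [|j IHj] i f g En fg.
  apply: eq_ssum => y /perm_size; rewrite size_tuple En => szy.
  have [[u z] /= [-> szu szz]] := cat_sizeP szy.
  have [[v x] /= [-> sv sx]] := @cat_sizeP z k m szz.
  by rewrite (fg u [::] v x) // wpar_nil scale1r.
pose h y := if drop i y is a :: z then
  (-1) ^+ (w a && wpar (take k z)) *: f (take i y ++ take k z ++ a :: drop k z)
  else 0.
have hE u a v x : size u = i -> size v = k ->
    h (u ++ a :: v ++ x) = (-1) ^+ (w a && wpar v) *: f (u ++ v ++ a :: x).
  by move=> su sv; rewrite /h drop_size_cat // !take_size_cat // drop_size_cat.
transitivity (ssum t h); last first.
  by apply: (@ssum_letter _ _ i k (j + m)) => [|u a v x su sv _]; [lia|apply: hE].
apply: (IHj i.+1); first by lia.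
move=> y v v' x; case/lastP: y => [//|u a].
rewrite size_rcons !cat_rcons => -[su] sv sv' sx.
rewrite (fg u (a :: v) v' x) //= ?sv // hE //.
by rewrite scalerA -signr_addb wpar_cons andb_addl addbC.
Qed.

(** Shuffling [m] letters inside a full symmetrization only repeats it: each of the [m]!
    rearrangements is undone by signed moves of letters and contributes the same sum. *)
Lemma ssum_absorb n (t : n.-tuple T) i m r f g : n = (i + (m + r))%N ->
  (forall u v x, size u = i -> size v = m -> size x = r ->
     g (u ++ v ++ x) = shuffle_sum v (fun v' => f (u ++ v' ++ x))) ->
  ssum t g = m`!%:R *: ssum t f.
Proof.
elim: m i f g => [|m IHm] i f g En fg.
  rewrite scale1r; apply: eq_ssum => y /perm_size; rewrite size_tuple En => szy.
  by have [[u x] /= [-> szu sx]] := cat_sizeP szy; rewrite (fg u [::] x).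
pose h y := if drop i y is a :: z then
    insert_sum a (take m z) (fun v => f (take i y ++ v ++ drop m z)) else 0.
have hE u a v x : size u = i -> size v = m ->
    h (u ++ a :: v ++ x) = insert_sum a v (fun v' => f (u ++ v' ++ x)).
  by move=> su sv; rewrite /h drop_size_cat // !take_size_cat // drop_size_cat.
rewrite (IHm i.+1 h); first 1 last.
- by lia.
- move=> y v x; case/lastP: y => [//|u a].
  rewrite size_rcons cat_rcons => -[su] sv sx.
  rewrite (fg u (a :: v) x) //= ?sv //.
  by apply: eq_shuffle_sum => v' /perm_size sv'; rewrite cat_rcons hE // sv' sv.
rewrite factS mulnC natrM -scalerA; congr (_ *: _).
(* The term of the insertion sum with the letter put after [j] others; by [ssum_letter] all [m.+1]
   of them have the same signed sum as [f]. *)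
pose hj j y := if drop i y is a :: z then
  (-1) ^+ (w a && wpar (take j z)) *: f (take i y ++ take j z ++ a :: drop j z)
  else 0.
rewrite (eq_ssum (g := fun y => \sum_(j < m.+1) hj j y)); last first.
  move=> y /perm_size; rewrite size_tuple En => szy.
  have [[u z] /= [-> su szz]] := cat_sizeP szy.
  case: z szz => // a z [szz].
  have [[v x] /= [-> sv sx]] := cat_sizeP szz.
  rewrite hE // /insert_sum sv; apply: eq_bigr => j _.
  have lejm : (j <= size v)%N by rewrite sv -ltnS.
  rewrite /hj drop_size_cat // (take_size_cat _ su) takel_cat // drop_cat.
  move: lejm; rewrite leq_eqVlt; case: ltngtP => //= [_ _|->]; rewrite -?catA //.
  by rewrite subnn drop0 drop_size.
rewrite ssum_sum -[m.+1 in RHS]card_ord scaler_nat -sumr_const.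
apply: eq_bigr => j _.
apply: (@ssum_letter _ _ i j (m - j + r)); first by have := ltn_ord j; lia.
move=> u a v x su sv _.
by rewrite /hj drop_size_cat // !take_size_cat // drop_size_cat.
Qed.

End SignedSums.

Lemma linear_ssum (R : comNzRingType) (T : eqType) (w : T -> bool)
    (V W : lmodType R) (phi : {linear V -> W}) n (t : n.-tuple T) f :
  phi (ssum w t f) = ssum w t (phi \o f).
Proof. by rewrite linear_sum; apply: eq_bigr => s _; rewrite linearZ. Qed.

Lemma linear_shuffle_sum (R : comNzRingType) (T : eqType) (w : T -> bool)
    (V W : lmodType R) (phi : {linear V -> W}) (l : seq T) f :
  phi (shuffle_sum w l f) = shuffle_sum w l (phi \o f).
Proof. by rewrite -!(ssumE w (in_tuple l)) linear_ssum. Qed.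

(** * Nested brackets *)

Section Brackets.
Variables (F : fieldType) (eps : bool) (A : gradedLie F eps).
Implicit Types (p q r : bool) (a b : A) (u v l : seq (bool * A)).

(* Letters carry the shifted parity [epsilon_a + epsilon], with respect to which
   the bracket is even whatever [eps]. *)
Definition shomog p a := homog (p (+) eps) a.

Lemma shomog_brac p q a b :
  shomog p a -> shomog q b -> shomog (p (+) q) (brac A a b).
Proof.
move=> pa qb; have := brac_homog pa qb; rewrite /shomog.
by congr (gproj _ _ _ = _); case: (p); case: (q); case: (eps).
Qed.

Lemma shomog_anti p q a b : shomog p a -> shomog q b ->
  brac A b a = - ((-1) ^+ (p && q) *: brac A a b).
Proof. by move=> pa qb; rewrite (brac_anti pa qb) !addbK. Qed.

(** The Jacobi identity solved for the first double bracket: bracketing with [x] from the right is a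
    graded derivation. *)
Lemma shomog_leibniz p q r a b (x : A) : shomog p a -> shomog q b -> shomog r x ->
  brac A (brac A a b) x =
    brac A a (brac A b x) + (-1) ^+ (q && r) *: brac A (brac A a x) b.
Proof.
move=> pa qb rx; have := brac_jacobi pa qb rx; rewrite !addbK.
rewrite (shomog_anti pa (shomog_brac qb rx)) (shomog_anti pa rx) linearNl.
rewrite linearZl_LR /= !scalerN !scalerA -!signr_addb => E.
(* Multiplying by this sign makes the coefficient of the double bracket to be isolated equal to
   1. *)
have {}E : (-1) ^+ (p && r) *: ((-1) ^+ (p && r) *: brac A (brac A a b) x
   - (-1) ^+ ((q && p) (+) p && (q (+) r)) *: brac A a (brac A b x)
   - (-1) ^+ ((r && q) (+) (p && r)) *: brac A (brac A a x) b) = 0.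
  by rewrite E scaler0.
move: E; rewrite !scalerBr !scalerA -!signr_addb addbb scale1r.
move/eqP; rewrite subr_eq add0r subr_eq => /eqP ->; rewrite addrC.
by congr (_ + _ *: _); [rewrite -[RHS]scale1r; congr (_ *: _)|];
  case: (p); case: (q); case: (r).
Qed.

Definition good l := all (fun x : bool * A => gproj A (x.1 (+) eps) x.2 == x.2) l.

Definition nest (x : A) l := foldl (brac A) x [seq y.2 | y <- l].

Notation lpar := (wpar (@fst bool A)).

Lemma nest_cat (x : A) u v : nest x (u ++ v) = nest (nest x u) v.
Proof. by rewrite /nest map_cat foldl_cat. Qed.

Lemma good_cat u v : good (u ++ v) = good u && good v.
Proof. exact: all_cat. Qed.

Lemma good_perm u v : perm_eq u v -> good u = good v.
Proof. exact: perm_all. Qed.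

Lemma shomog_nest p (x : A) l :
  shomog p x -> good l -> shomog (p (+) lpar l) (nest x l).
Proof.
elim: l p x => [|y l IHl] p x px /=; first by rewrite wpar_nil addbF.
by case/andP=> /eqP gy gl; rewrite wpar_cons addbA; apply: IHl => //;
   apply: shomog_brac.
Qed.

Lemma nestD l x x' : nest (x + x') l = nest x l + nest x' l.
Proof.
by elim: l x x' => // y l IHl x x'; rewrite /nest /= linearDl; apply: IHl.
Qed.

Lemma nestZ l c x : nest (c *: x) l = c *: nest x l.
Proof.
by elim: l x => // y l IHl x; rewrite /nest /= linearZl_LR; apply: IHl.
Qed.

(** The list form accepts the pieces of a word that has been cut, whatever their lengths. *)
Definition sderived (Q : A) (l : seq A) : A := derived Q (in_tuple l).

Lemma derived_seq (Q : A) n (a : n.-tuple A) : derived Q a = sderived Q a.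
Proof.
case: a => l e; have E := eqP e; subst n.
by congr (derived _ _); apply: val_inj.
Qed.

(** On homogeneous letters the sum over components collapses by [derivedE], and the two shifts by
    [eps] cancel in the Koszul sign. *)
Lemma derived_letters (Q : A) l : good l ->
  sderived Q [seq y.2 | y <- l] = (size l)`!%:R^-1 *: shuffle_sum fst l (nest Q).
Proof.
move=> gl; rewrite -(ssumE _ (in_tuple l)).
have -> : sderived Q [seq y.2 | y <- l] = derived Q (map_tuple snd (in_tuple l)).
  by rewrite derived_seq.
rewrite (@derivedE _ _ _ _ _ [ffun i => (tnth (in_tuple l) i).1 (+) eps]).
  congr (_ *: _); apply: eq_bigr => s _; congr ((-1) ^+ nat_of_bool _ *: _).
    by do 2![apply: eq_bigr => ? _]; rewrite /= !ffunE !addbK !addbF.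
  rewrite /nest -map_comp; congr foldl; rewrite /=.
  by apply: eq_map => i /=; rewrite tnth_map.
move=> i; rewrite ffunE tnth_map; apply/eqP.
by move/all_tnthP: (gl : good (in_tuple l)); apply.
Qed.

Lemma shomog_derived (Q : A) p l : shomog p Q -> good l ->
  shomog (p (+) lpar l) (sderived Q [seq y.2 | y <- l]).
Proof.
move=> pQ gl; rewrite derived_letters // /shomog /homog linearZ linear_shuffle_sum /=.
congr (_ *: _); apply: eq_shuffle_sum => u ul /=.
rewrite -(wpar_perm _ ul); apply: shomog_nest => //.
by rewrite (good_perm ul).
Qed.

(** * Leibniz rule for brackets of two nested brackets *)

Section Square.
Variable Q : A.
Hypothesis homQ : homog (~~ eps) Q.

Lemma shomogQ : shomog true Q.
Proof. by []. Qed.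

Lemma shomog_nestQ l : good l -> shomog (~~ lpar l) (nest Q l).
Proof. exact: shomog_nest shomogQ. Qed.

Variables (n : nat) (t : n.-tuple (bool * A)).
Hypothesis good_t : good t.

(** The graded symmetrization of [Q_i, Q_(n-i)], without division by [n]!. The sign is that of
    moving the second, odd, [Q] past the first [i] letters. *)
Definition split_bracket i : A :=
  ssum fst t (fun y => (-1) ^+ lpar (take i y) *:
    brac A (nest Q (take i y)) (nest Q (drop i y))).

(** As [Q] is odd in the shifted parity, graded antisymmetry turns into symmetry once [ssum_block]
    has exchanged the two blocks of letters. *)
Lemma split_bracket_sym i : (i <= n)%N ->
  split_bracket (n - i) = split_bracket i.
Proof.
move=> lein; pose h y := let u := take i y in let v := drop i y in
  (-1) ^+ (lpar v (+) (lpar u && lpar v)) *: brac A (nest Q v) (nest Q u).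
transitivity (ssum fst t h).
  apply: (@ssum_block _ _ _ _ _ _ 0 (n - i) i 0); first by lia.
  move=> [] // v v' [] // _ sv sv' _; rewrite !cat0s !cats0 /h.
  rewrite !take_size_cat // !drop_size_cat // scalerA -signr_addb.
  by congr ((-1) ^+ _ *: _); case: (lpar v); case: (lpar v').
apply: eq_ssum => y yt.
have := good_t; rewrite -(good_perm yt) -{1}(cat_take_drop i y) good_cat.
case/andP=> gu gv; rewrite /h.
rewrite (shomog_anti (shomog_nestQ gu) (shomog_nestQ gv)) -scaleNr -signrN.
rewrite scalerA -signr_addb; congr ((-1) ^+ _ *: _).
by case: (lpar _); case: (lpar _).
Qed.

(** The graded symmetrization of D^r [Q_i, Q_k] with r = n - i - k, where D is bracketing with a
    further letter. *)
Definition triple_bracket i k : A :=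
  ssum fst t (fun y => (-1) ^+ lpar (take i y) *:
    nest (brac A (nest Q (take i y)) (nest Q (take k (drop i y)))) (drop k (drop i y))).

(** The Leibniz rule for the first letter after the two blocks: it joins either the second block or,
    after being moved past it, the first. *)
Lemma triple_bracketS i k : (i + k < n)%N ->
  triple_bracket i k = triple_bracket i k.+1 + triple_bracket i.+1 k.
Proof.
move=> ltn; pose g1 y := (-1) ^+ lpar (take i y) *:
  nest (brac A (nest Q (take i y)) (nest Q (take k.+1 (drop i y))))
    (drop k.+1 (drop i y)).
(* Here [c] has passed the second nested bracket, of parity [~~ lpar v]. Moving [c] past the letters
   [v] in the word costs [lpar v && c.1], which leaves the sign of [rcons u c]. *)
pose g2 y := let u := take i y in let v := take k (drop i y) in
  if drop k (drop i y) is c :: x then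
    (-1) ^+ (lpar u (+) (~~ lpar v && c.1)) *:
      nest (brac A (nest Q (rcons u c)) (nest Q v)) x else 0.
transitivity (ssum fst t (fun y => g1 y + g2 y)).
  apply: eq_ssum => y yt; have gy := good_t; rewrite -(good_perm yt) in gy.
  have sz : size y = (i + (k + (n - i - k - 1).+1))%N.
    by rewrite (perm_size yt) size_tuple; lia.
  have [[u z] /= [Ey su szz]] := cat_sizeP sz.
  have [[v x] /= [Ez sv]] := cat_sizeP szz.
  case: x Ez => // c x Ez _; subst y z.
  rewrite /g1 /g2 take_size_cat // drop_size_cat // take_size_cat // drop_size_cat //.
  rewrite -cat_rcons take_size_cat ?drop_size_cat ?size_rcons ?sv //.
  move: gy; rewrite !good_cat /= => /and4P[gu gv /eqP gc gx].
  rewrite signr_addb -scalerA -scalerDr; congr (_ *: _).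
  rewrite -nestZ -nestD /nest /=; congr foldl.
  rewrite -!cats1 !map_cat !foldl_cat /=.
  exact: (shomog_leibniz (shomog_nestQ gu) (shomog_nestQ gv) gc).
rewrite ssumD; congr (_ + _).
apply: (@ssum_block _ _ _ _ _ _ i k 1 (n - i - k - 1)); first by lia.
move=> u v [|c []] // x su sv _ _; rewrite /g2.
rewrite !(take_size_cat _ su) !(drop_size_cat _ su) take_size_cat //.
rewrite drop_size_cat //=.
rewrite -cat_rcons take_size_cat ?drop_size_cat ?size_rcons ?su //.
rewrite take_size_cat // scalerA -signr_addb -cats1 wpar_cat.
rewrite !wpar_cons wpar_nil.
by congr ((-1) ^+ _ *: _); case: (lpar u); case: (lpar v); case: (c.1).
Qed.

(** The iterated Leibniz rule; [triple_bracketS] reproduces Pascal's rule. *)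
Lemma triple_bracketE i k (r : nat) : (i + k + r = n)%N ->
  triple_bracket i k = \sum_(j < r.+1) split_bracket (i + j) *+ 'C(r, j).
Proof.
elim: r i k => [|r IHr] i k En.
  rewrite big_ord1 addn0 bin0 mulr1n; apply: eq_ssum => y /perm_size.
  rewrite size_tuple => szy.
  have sd : size (drop i y) = k by rewrite size_drop szy; lia.
  by rewrite -sd take_size drop_size.
rewrite triple_bracketS; last by lia.
rewrite !IHr; try lia.
rewrite [RHS]big_ord_recl bin0 /= [in RHS](eq_bigr (fun j : 'I_r.+1 =>
  split_bracket (i + j.+1) *+ 'C(r, j.+1) + split_bracket (i.+1 + j) *+ 'C(r, j))).
  rewrite big_split /= addrA; congr (_ + _).
  by rewrite big_ord_recl bin0 big_ord_recr /= bin_small // mulr0n addr0.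
by move=> j _; rewrite /= binS mulrnDr addSnnS.
Qed.

End Square.
End Brackets.

(** On the left [f i] has the coefficient \sum_(j <= i) 'C(m - j, i - j), a hockey-stick sum. *)
Lemma sum_hockey_stick (V : nmodType) (m : nat) (f : nat -> V) :
  \sum_(j < m.+1) \sum_(l < (m - j).+1) f (j + l)%N *+ 'C(m - j, l) =
    \sum_(i < m.+1) f i *+ 'C(m.+1, i).
Proof.
elim: m f => [|m IHm] f; first by rewrite !big_ord1 /= !bin0.
rewrite big_ord_recl subn0 /=.
under [X in _ + X]eq_bigr => j _ do
  rewrite (eq_bigr (fun l : 'I__ => f (j + l).+1 *+ 'C(m - j, l))) //.
rewrite (IHm (fun i => f i.+1)) big_ord_recl [RHS]big_ord_recl !bin0 -addrA.
congr (_ + _); rewrite -big_split /=; apply: eq_bigr => i _.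
by rewrite /bump /= !add1n [in RHS]binS mulrnDr.
Qed.

Section NatFractions.
Variable F : numFieldType.

Lemma natf_fact m : m`!%:R != 0 :> F.
Proof. by rewrite Num.Theory.pnatr_eq0 -lt0n fact_gt0. Qed.

Lemma natf_succ m : m.+1%:R != 0 :> F.
Proof. by rewrite Num.Theory.pnatr_eq0. Qed.

Lemma natr_bin m i : (i <= m)%N ->
  'C(m, i)%:R = m`!%:R / (i`!%:R * (m - i)`!%:R) :> F.
Proof.
by move=> leim; rewrite -(bin_fact leim) !natrM mulfK // mulf_neq0 ?natf_fact.
Qed.

End NatFractions.

(** * One derived bracket inserted into another *)

Section Compositions.
Variables (F : numFieldType) (eps : bool) (A : gradedLie F eps) (Q : A).
Implicit Types (u v l : seq (bool * A)).
Notation lpar := (wpar (@fst bool A)).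

(** The outer bracket with its special argument [Y], of shifted parity [c], put at every place among
    the letters [u] in a fixed order. Linearity in [Y] allows the inner symmetrization to be pulled
    out. *)
Definition ins_nest c u (Y : A) : A := insert_sum fst (c, Y) u (nest Q).

Lemma ins_nest_is_linear c u : linear (ins_nest c u).
Proof.
move=> z Y Y'; rewrite /ins_nest /insert_sum scaler_sumr -big_split.
apply: eq_bigr => j _; rewrite !nest_cat /= scalerA mulrC -scalerA -scalerDr.
by congr (_ *: _); rewrite /nest /= linearPr -!/(nest _ _) nestD nestZ.
Qed.

HB.instance Definition _ c u :=
  GRing.isLinear.Build F A A *:%R (ins_nest c u) (ins_nest_is_linear c u).

Hypothesis homQ : homog (~~ eps) Q.
Variables (n : nat) (t : n.-tuple (bool * A)).
Hypothesis good_t : good t.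

Lemma derived_derived k m : (n = k + m)%N ->
  ssum fst t (fun y => sderived Q
    (sderived Q [seq x.2 | x <- take k y] :: [seq x.2 | x <- drop k y])) =
  m.+1%:R^-1 *: \sum_(i < m.+1) split_bracket Q t i *+ 'C(m.+1, i).
Proof.
move=> En.
pose h1 y := ins_nest (~~ lpar (take k y)) (drop k y)
  (sderived Q [seq x.2 | x <- take k y]).
pose h2 y := ins_nest (~~ lpar (take k y)) (drop k y) (nest Q (take k y)).
transitivity (m.+1`!%:R^-1 *: (m`!%:R *: ssum fst t h1)).
  (* The inner bracket is the first letter of the outer one, so [shuffle_sum] inserts it last; the
     shuffle of the other [m] letters is absorbed and yields [m]!. *)
  pose h0 y := let v := take k y in
    shuffle_sum fst (drop k y)
      (fun u => ins_nest (~~ lpar v) u (sderived Q [seq x.2 | x <- v])).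
  rewrite -(@ssum_absorb _ _ _ _ _ _ k m 0 h1 h0) ?addn0 // => [|u v [] // su sv _].
    rewrite -ssumZ; apply: eq_ssum => y yt.
    have := good_t; rewrite -(good_perm yt) -{1}(cat_take_drop k y) good_cat.
    case/andP=> gu gv; have sd : size (drop k y) = m.
      by rewrite size_drop (perm_size yt) size_tuple En addKn.
    have := @derived_letters _ _ _ Q
      ((~~ lpar (take k y), sderived Q [seq x.2 | x <- take k y]) :: drop k y).
    rewrite /= sd => -> //; apply/andP; split=> //=.
    by apply/eqP; apply: (@shomog_derived _ _ _ _ true).
  rewrite cats0 /h0 drop_size_cat // take_size_cat //.
  apply: eq_shuffle_sum => w wv; rewrite cats0 /h1 drop_size_cat // take_size_cat //.
transitivity (m.+1`!%:R^-1 *: (m`!%:R *: ssum fst t h2)).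
  do 2!congr (_ *: _).
  (* The inner shuffle of the first [k] letters is absorbed likewise, its factor [k]! cancelling the
     denominator of the inner bracket. *)
  pose h3 y := shuffle_sum fst (take k y)
    (fun v => ins_nest (~~ lpar v) (drop k y) (nest Q v)).
  apply: (scalerI (natf_fact F k)).
  rewrite -(@ssum_absorb _ _ _ _ _ _ 0 k m h2 h3) //; last first.
    move=> [] // v x _ sv sx; rewrite !cat0s /h3 drop_size_cat // take_size_cat //.
    apply: eq_shuffle_sum => w /perm_size; rewrite sv => sw.
    by rewrite cat0s /h2 drop_size_cat // take_size_cat.
  rewrite -ssumZ; apply: eq_ssum => y yt.
  have := good_t; rewrite -(good_perm yt) -{1}(cat_take_drop k y) good_cat.
  case/andP=> gu gv; rewrite /h1 /h3 derived_letters // linearZ linear_shuffle_sum.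
  have -> : size (take k y) = k.
    by rewrite size_takel // (perm_size yt) size_tuple En leq_addr.
  rewrite scalerA mulfV ?natf_fact // scale1r; apply: eq_shuffle_sum => w /= wk.
  by rewrite (wpar_perm _ wk).
(* If the inner bracket comes after [j] of the remaining letters, moving these [j] letters to the
   front of the word gives D^(m-j) [Q_j, Q_k]. *)
have -> : ssum fst t h2 = \sum_(j < m.+1) triple_bracket Q t j k.
  pose hj j y := (-1) ^+ (~~ lpar (take k y) && lpar (take j (drop k y))) *:
    nest (brac A (nest Q (take j (drop k y))) (nest Q (take k y))) (drop j (drop k y)).
  rewrite (eq_ssum _ (g := fun y => \sum_(j < m.+1) hj j y)); last first.
    move=> y yt; rewrite /h2 /ins_nest /insert_sum.
    have -> : size (drop k y) = m.
      by rewrite size_drop (perm_size yt) size_tuple En addKn.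
    by apply: eq_bigr => j _; rewrite nest_cat.
  rewrite ssum_sum; apply: eq_bigr => j _.
  apply: (@ssum_block _ _ _ _ _ _ 0 k j (m - j)).
    by have := ltn_ord j; lia.
  move=> [] // v v' x _ sv sv' _; rewrite !cat0s /hj.
  rewrite !(take_size_cat _ sv) !(drop_size_cat _ sv).
  rewrite !(take_size_cat _ sv') !(drop_size_cat _ sv').
  rewrite take_size_cat // drop_size_cat // scalerA -signr_addb.
  by congr ((-1) ^+ _ *: _); case: (lpar v); case: (lpar v').
rewrite -sum_hockey_stick scalerA factS natrM invfM mulfVK ?natf_fact //.
congr (_ *: _); apply: eq_bigr => j _; apply: triple_bracketE => //.
by have := ltn_ord j; lia.
Qed.

End Compositions.

(** * Expansion of both sides of the square relations *)

Section Products.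
Variables (F : numFieldType) (eps : bool) (A : gradedLie F eps) (Q : A).
Hypothesis homQ : homog (~~ eps) Q.
Variables (n : nat) (a : n.-tuple A).

Definition letters (p : {ffun 'I_n -> bool}) : n.-tuple (bool * A) :=
  [tuple (p i (+) eps, gproj A (p i) (tnth a i)) | i < n].

Lemma good_letters p : good (letters p).
Proof.
by apply/all_tnthP => i; rewrite tnth_mktuple addbK gproj_idem eqxx.
Qed.

Lemma sum_koszul (V : lmodType F) (p : {ffun 'I_n -> bool}) (f : seq (bool * A) -> V) :
  \sum_(s : 'S_n) (-1) ^+ koszul eps p s *:
    f [seq tnth (letters p) (s i) | i <- enum 'I_n] = ssum fst (letters p) f.
Proof.
apply: eq_bigr => s _; congr ((-1) ^+ nat_of_bool _ *: _).
by do 2![apply: eq_bigr => ? _]; rewrite /= !tnth_mktuple !addbF.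
Qed.

Definition split_sum i : A := \sum_p split_bracket Q (letters p) i.

Lemma split_sum_sym i : (i <= n)%N -> split_sum (n - i) = split_sum i.
Proof.
move=> lein; apply: eq_bigr => p _; apply: split_bracket_sym => //.
exact: good_letters.
Qed.

Definition lam (c : nat -> F) (m : nat) : F :=
  \sum_(k < m.+1) c k * 'C(m.+1, k)%:R / m.+1%:R.

(** The symmetrized D^n [Q_0, Q_0], that is, the iterated Leibniz rule with both blocks empty. *)
Lemma derived_sqE :
  derived (brac A Q Q) a =
    \sum_(i < n.+1) (i`!%:R * (n - i)`!%:R)^-1 *: split_sum i.
Proof.
transitivity (n`!%:R^-1 *: \sum_p triple_bracket Q (letters p) 0 0).
  congr (_ *: _); apply: eq_bigr => p _.
  rewrite /triple_bracket -sum_koszul; apply: eq_bigr => s _.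
  rewrite !take0 wpar_nil scale1r /nest /= !drop0; congr (_ *: foldl _ _ _).
  by rewrite /= -map_comp; apply: eq_map => i; rewrite /= tnth_mktuple.
rewrite (eq_bigr _ (fun p _ =>
  @triple_bracketE _ _ _ _ homQ _ _ (good_letters p) 0 0 n erefl)).
rewrite exchange_big scaler_sumr; apply: eq_bigr => i _ /=.
rewrite sumrMnl -scaler_nat scalerA; congr (_ *: _).
have lein : (i <= n)%N by rewrite -ltnS.
rewrite -(bin_fact lein) !natrM invfM mulrC mulrA mulfV ?mul1r //.
by rewrite Num.Theory.pnatr_eq0 -lt0n bin_gt0.
Qed.

Lemma bprodE (c : 'rV[F]_n.+1) :
  bprod_n eps c (derived Q) (derived Q) a =
    \sum_(m < n.+1)
      lam (fun k => c 0 (inord k)) m / (m`!%:R * (n - m)`!%:R) *: split_sum m.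
Proof.
transitivity (\sum_(k < n.+1) (c 0 k / (k`!%:R * (n - k)`!%:R)) *:
   ((n - k).+1%:R^-1 *: \sum_(i < (n - k).+1) split_sum i *+ 'C((n - k).+1, i))).
  apply: eq_bigr => k _; congr (_ *: _).
  have lekn : (k <= n)%N by rewrite -ltnS.
  have -> : \sum_(i < (n - k).+1) split_sum i *+ 'C((n - k).+1, i) =
      \sum_p \sum_(i < (n - k).+1) split_bracket Q (letters p) i *+ 'C((n - k).+1, i).
    by rewrite exchange_big; apply: eq_bigr => i _; rewrite sumrMnl.
  rewrite scaler_sumr.
  apply: eq_bigr => p _.
  rewrite -(derived_derived homQ (good_letters p) (esym (subnKC lekn))).
  rewrite -sum_koszul; apply: eq_bigr => s _; congr (_ *: _).
  set b := [tuple gproj A (p (s i)) (tnth a (s i)) | i < n].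
  set y := [seq tnth (letters p) (s i) | i <- enum 'I_n].
  have Eb : b = [seq x.2 | x <- y] :> seq A.
    by rewrite -map_comp -val_ord_tuple; apply: eq_map => i; rewrite /= tnth_mktuple.
  cbv zeta; rewrite derived_seq; congr (sderived _ (_ :: _)).
    rewrite derived_seq map_take -Eb; congr sderived.
    apply: (@eq_from_nth _ 0) => [|i].
      by rewrite size_tuple size_takel ?size_tuple.
    rewrite size_tuple => lti; rewrite nth_take //.
    by rewrite -[i in LHS]/(val (Ordinal lti)) nth_mktuple.
  rewrite map_drop -Eb; apply: (@eq_from_nth _ 0) => [|i].
    by rewrite size_tuple size_drop size_tuple.
  rewrite size_tuple => lti; rewrite nth_drop.
  by rewrite -[i in LHS]/(val (Ordinal lti)) nth_mktuple.
(* The coefficient of [split_sum m] coming from [c 0 k]. The symmetry of [split_sum] is used to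
   replace the index i <= n - k by m = n - i >= k, so that only [k <= m] contributes. *)
pose G (k m : nat) : A := if (k <= m)%N then
  (c 0 (inord k) / (k`!%:R * (n - m)`!%:R * (m.+1 - k)`!%:R)) *: split_sum m else 0.
transitivity (\sum_(k < n.+1) \sum_(m < n.+1) G k m).
  apply: eq_bigr => k _; rewrite scalerA scaler_sumr.
  have lekn : (k <= n)%N by rewrite -ltnS.
  rewrite (big_ord_widen n.+1 (fun i => _ *: (split_sum i *+ 'C(_, i))));
    last by rewrite ltnS leq_subr.
  rewrite big_mkcond (reindex_inj rev_ord_inj); apply: eq_bigr => m _ /=.
  have lemn : (m <= n)%N by rewrite -ltnS.
  rewrite subSS ltnS /G (_ : (n - m <= n - k)%N = (k <= m)%N); last by lia.
  case: ifP => // lekm; rewrite split_sum_sym // -scaler_nat scalerA inord_val.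
  congr (_ *: _).
  have lei : (n - m <= (n - k).+1)%N by lia.
  rewrite natr_bin // (_ : ((n - k).+1 - (n - m) = m.+1 - k)%N); last by lia.
  rewrite factS natrM; move: (c 0 k) (natf_fact F k) (natf_fact F (n - k)).
  move: (natf_fact F (n - m)) (natf_fact F (m.+1 - k)) (natf_succ F (n - k)).
  move: _%:R _%:R _%:R _%:R _%:R => x1 x2 x3 x4 x5 h1 h2 h3 cc h4 h5; field.
  by rewrite h1 h2 h3 h4 h5.
rewrite exchange_big /=; apply: eq_bigr => m _; rewrite /lam mulr_suml scaler_suml.
rewrite (big_ord_widen n.+1 (fun k => (c 0 (inord k) * 'C(m.+1, k)%:R / m.+1%:R /
   (m`!%:R * (n - m)`!%:R)) *: split_sum m)) //.
rewrite [RHS]big_mkcond; apply: eq_bigr => k _; rewrite /G ltnS.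
case: ifP => // lekm; congr (_ *: _); rewrite -!mulrA; congr (_ * _).
have lek : (k <= m.+1)%N by lia.
rewrite natr_bin // factS natrM; move: (natf_fact F k) (natf_fact F (n - m)).
move: (natf_fact F (m.+1 - k)) (natf_fact F m) (natf_succ F m).
move: _%:R _%:R _%:R _%:R _%:R => x1 x2 x3 x4 x5 h1 h2 h3 h4 h5; field.
by rewrite h1 h2 h3 h4 h5.
Qed.

End Products.

(** * Coefficients *)

Section Lam.
Variable F : numFieldType.

Definition bern_shift (m k : nat) : F := 'C(k, m)%:R * bernoulli F (k%:Z - m%:Z).

(** Since 'C(k, m) 'C(j+1, k) = 'C(j+1, m) 'C(j+1-m, k-m), the sum reduces to the Bernoulli
    recursion \sum_(l < N) 'C(N, l) B_l = delta_(N,1) for N = j + 1 - m. *)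
Lemma lam_bern_shift m j : lam (bern_shift m) j = (j == m)%:R.
Proof.
rewrite /lam -(big_mkord xpredT
  (fun k => bern_shift m k * 'C(j.+1, k)%:R / j.+1%:R)).
case: (ltnP j m) => [ltjm|lemj].
  rewrite big_nat_cond big1 => [|k /andP[/andP[_ ltk] _]]; first by rewrite ltn_eqF.
  by rewrite /bern_shift bin_small ?mul0r //; lia.
rewrite (big_cat_nat (n := m)) //=; last by lia.
rewrite big_nat_cond big1 ?add0r => [|k /andP[/andP[_ ltk] _]]; last first.
  by rewrite /bern_shift bin_small ?mul0r.
rewrite -{1}[m]add0n big_addn big_mkord.
have := bernoulli_genE F (j.+1 - m); rewrite big_ord_recr /= subnn eqxx mulr0 addr0.
have -> : (j.+1 - m == 1)%N = (j == m) by lia.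
move/(congr1 (fun x => j`!%:R / m`!%:R * x)).
rewrite mulr_sumr => E.
transitivity (j`!%:R / m`!%:R * (j == m)%:R : F).
  rewrite -E; apply: eq_bigr => k _.
  have ltk : (k < j.+1 - m)%N by [].
  rewrite subn_eq0 leqNgt ltk /= /bern_shift.
  rewrite (_ : (k + m)%:Z - m%:Z = k) /=; last by rewrite PoszD addrK.
  rewrite !natr_bin ?leq_addl //; try lia.
  rewrite addnK (_ : (j.+1 - (k + m) = j.+1 - m - k)%N); last by lia.
  rewrite factS natrM; move: (bernoulli_nat F k) (natf_succ F j) (natf_fact F j).
  move: (natf_fact F (k + m)) (natf_fact F m) (natf_fact F k).
  move: (natf_fact F (j.+1 - m - k)).
  move: _%:R _%:R _%:R _%:R _%:R _%:R => x1 x2 x3 x4 x5 x6 h1 h2 h3 h4 b h5 h6.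
  by field; rewrite h1 h2 h3 h4 h5.
by case: eqP => [->|_]; rewrite ?mulr0 // mulr1 mulfV // natf_fact.
Qed.

(** The Bernoulli part contributes only at [j] = 0. The Kronecker delta contributes 'C(j+1, 1) /
    (j+1) = 1 for positive [j], and nothing at [j] = 0, where the sum stops before [k] = 1. *)
Lemma lam_sol j :
  lam (fun k => bernoulli F k + (k == 1)%N%:R) j = 1.
Proof.
have -> : lam (fun k => bernoulli F k + (k == 1)%N%:R) j =
    lam (bern_shift 0) j + lam (fun k => (k == 1)%N%:R) j.
  rewrite /lam -big_split; apply: eq_bigr => k _ /=.
  by rewrite /bern_shift bin0 mul1r subr0 -!mulrDl.
rewrite lam_bern_shift /lam; case: j => [|j].
  by rewrite big_ord1 !mul0r addr0.
rewrite (bigD1 (lift ord0 ord0)) //= big1 ?addr0 => [|k nek].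
  by rewrite add0r mul1r bin1 mulfV ?natf_succ.
by rewrite -val_eqE /= in nek; rewrite (negbTE nek) !mul0r.
Qed.

Lemma lamB (c d : nat -> F) m : lam (fun k => c k - d k) m = lam c m - lam d m.
Proof. by rewrite /lam -sumrB; apply: eq_bigr => k _; rewrite !mulrBl. Qed.

Definition row_lam n (c : 'rV[F]_n.+1) := lam (fun k => c 0 (inord k)).

Lemma row_lamE n (c : 'rV[F]_n.+1) (d : nat -> F) m : (m <= n)%N ->
  (forall k : 'I_n.+1, c 0 k = d k) -> row_lam c m = lam d m.
Proof.
move=> lemn cd; apply: eq_bigr => k _; rewrite cd inordK //.
by have := ltn_ord k; lia.
Qed.

(** By [lam_bern_shift] the matrix of the tuples [bern_shift m] times that of the functionals
    [row_lam] is the identity; both being square, the product in the other order is too. *)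
Lemma sum_row_lam n (c : 'rV[F]_n.+1) :
  c = \sum_(m < n.+1) row_lam c m *: \row_(k < n.+1) bern_shift m k.
Proof.
pose E := \matrix_(m < n.+1, k < n.+1) bern_shift m k.
pose N := \matrix_(k < n.+1, m < n.+1)
  if (k < m.+1)%N then 'C(m.+1, k)%:R / m.+1%:R else 0 : F.
have vN (v : 'rV[F]_n.+1) m : (v *m N) 0 m = row_lam v m.
  rewrite mxE /row_lam /lam (big_ord_widen n.+1
    (fun k => v 0 (inord k) * 'C(m.+1, k)%:R / m.+1%:R)) //.
  rewrite [RHS]big_mkcond; apply: eq_bigr => k _; rewrite mxE inord_val.
  by case: ifP; rewrite ?mulr0 // mulrA.
have EN : E *m N = 1%:M.
  apply/matrixP => i m; have -> : (E *m N) i m = (row i E *m N) 0 m.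
    by rewrite -row_mul [RHS]mxE.
  rewrite vN (row_lamE (d := bern_shift i)) ?lam_bern_shift -1?ltnS //.
    by rewrite mxE eq_sym.
  by move=> k; rewrite !mxE.
rewrite -[LHS]mulmx1 -(mulmx1C EN) mulmxA [LHS]mulmx_sum_row.
apply: eq_bigr => m _; rewrite vN; congr (_ *: _).
by apply/rowP => k; rewrite !mxE.
Qed.

Lemma hom_basisE n m : (m <= n)%N -> hom_basis F n m =
  \row_(k < n.+1) bern_shift m k - \row_(k < n.+1) bern_shift (n - m) k.
Proof.
move=> lemn; apply/rowP => k; rewrite !mxE; congr (_ - _ * bernoulli F _).
by rewrite -subzn // opprB addrA addrAC.
Qed.

Lemma row_lam_hom_basis n m j : (m <= n)%N -> (j <= n)%N ->
  row_lam (hom_basis F n m) j = (j == m)%:R - (j == n - m)%N%:R.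
Proof.
move=> lemn lejn.
rewrite (row_lamE (d := fun k => bern_shift m k - bern_shift (n - m) k)) //.
  by rewrite lamB !lam_bern_shift.
by move=> k; rewrite hom_basisE // !mxE.
Qed.

Lemma row_lam_sum n I (r : seq I) (P : pred I) (mu : I -> F) (c : I -> 'rV_n.+1) m :
  row_lam (\sum_(i <- r | P i) mu i *: c i) m =
    \sum_(i <- r | P i) mu i * row_lam (c i) m.
Proof.
under [RHS]eq_bigr => i _ do rewrite mulr_sumr.
rewrite exchange_big; apply: eq_bigr => k _; rewrite summxE /= !mulr_suml.
by apply: eq_bigr => i _; rewrite mxE !mulrA.
Qed.

(** The terms [m] and [n - m] are paired. *)
Lemma sum_antisym (V : lmodType F) n (x : nat -> F) (f : nat -> V) :
  (forall m, (m <= n)%N -> x m = - x (n - m)%N) ->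
  \sum_(m < n.+1) x m *: f m =
    \sum_(m < (n + 1) %/ 2) x m *: (f m - f (n - m)%N).
Proof.
move=> xA; rewrite divn2 addn1.
rewrite (bigID (fun m : 'I_n.+1 => (m < uphalf n)%N)) /=.
rewrite [X in _ + X](reindex_inj rev_ord_inj) /=.
rewrite (big_ord_widen n.+1 (fun m => x m *: (f m - f (n - m)%N))); last by lia.
rewrite [X in _ + X](_ : _ = \sum_(m < n.+1 | (m < uphalf n)%N) - (x m *: f (n - m)%N)).
  by rewrite -big_split; apply: eq_bigr => m _ /=; rewrite scalerBr.
rewrite big_mkcond [RHS]big_mkcond; apply: eq_bigr => m _; rewrite subSS.
have lemn : (m <= n)%N by rewrite -ltnS.
case: ifP; case: ifP => //; try lia.
  by move=> _ _; rewrite (xA m) // scaleNr opprK.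
(* The middle index of an even [n] has no partner; there [x m] equals its own negative and vanishes
   in characteristic 0. *)
move=> ltm ltnm; have Em : (n - m)%N = m by lia.
have /eqP := xA m lemn; rewrite Em -addr_eq0 -mulr2n -mulr_natl mulf_eq0.
by rewrite Num.Theory.pnatr_eq0 /= => /eqP ->; rewrite scale0r.
Qed.

End Lam.

(** * Sufficient condition on the coordinates *)

Section Relations.
Variable F : numFieldType.

(** Twice the expansion [bprodE], with one copy read backwards, involves the coordinates only
    through the sums in the hypothesis. The value [z] = 0 serves the homogeneous problem and [z] = 1
    the square relations. *)
Lemma bprod_symmetric (n : nat) (c : 'rV[F]_n.+1) (z : F)
    (eps : bool) (A : gradedLie F eps) (Q : A) (a : n.-tuple A) :
  homog (~~ eps) Q ->
  (forall m, (m <= n)%N -> row_lam c m + row_lam c (n - m) = z *+ 2) ->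
  bprod_n eps c (derived Q) (derived Q) a = z *: derived (brac A Q Q) a.
Proof.
move=> homQ cz; rewrite (bprodE homQ) (derived_sqE homQ).
have two : 2%:R != 0 :> F by rewrite Num.Theory.pnatr_eq0.
apply: (scalerI two); rewrite !scaler_nat mulr2n.
rewrite [X in _ + X](reindex_inj rev_ord_inj) -big_split /= scaler_sumr -sumrMnl.
apply: eq_bigr => m _; have lemn : (m <= n)%N by rewrite -ltnS.
rewrite subSS subKn // split_sum_sym // [(n - m)`!%:R * _]mulrC -scalerDl -mulrDl.
by rewrite cz // scalerA scalerMnl -mulrnAl.
Qed.

End Relations.

(* Even part spanned by [a] and a vector [t], odd part by [u] and [v], with
   [u,v] = [v,u] = t, [u,a] = alpha u, [v,a] = v and [t,a] = (alpha + 1) t. *)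
Section Example.
Variables (F : numFieldType) (alpha : F).

Definition osc : lmodType F := ((F^o * F^o) * (F^o * F^o))%type.
Implicit Types x y : osc.

Definition osc_brac x y : osc :=
  let: ((a1, t1), (u1, v1)) := x in let: ((a2, t2), (u2, v2)) := y in
  ((0, u1 * v2 + v1 * u2 + (alpha + 1) * (t1 * a2 - a1 * t2)),
   (alpha * (u1 * a2 - a1 * u2), v1 * a2 - a1 * v2)).

Lemma osc_brac_bilinear : bilinear_for
  (GRing.Scale.Law.clone _ _ *:%R _) (GRing.Scale.Law.clone _ _ *:%R _) osc_brac.
Proof.
by split=> [] [[a1 t1] [u1 v1]] c [[a2 t2] [u2 v2]] [[a3 t3] [u3 v3]];
  congr ((_, _), (_, _)); rewrite /= /GRing.scale /=; ring.
Qed.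

HB.instance Definition _ :=
  bilinear_isBilinear.Build F osc osc osc _ _ osc_brac osc_brac_bilinear.

Definition osc_proj (p : bool) x : osc := if p then (0, x.2) else (x.1, 0).

Lemma osc_proj_linear p : linear (osc_proj p).
Proof.
by case: p => c x y; rewrite /osc_proj; congr (_, _); rewrite /= scaler0 addr0.
Qed.

HB.instance Definition _ p :=
  GRing.isLinear.Build F osc osc *:%R (osc_proj p) (osc_proj_linear p).

Lemma osc_proj_idem p q x :
  osc_proj p (osc_proj q x) = if p == q then osc_proj p x else 0.
Proof. by case: p; case: q. Qed.

Lemma osc_proj_sum x : osc_proj false x + osc_proj true x = x.
Proof. by case: x => x1 x2; congr (_, _); rewrite /= ?addr0 ?add0r. Qed.

Definition osc_vect : gradedVect F :=
  @GradedVect F osc (fun p => osc_proj p) osc_proj_idem osc_proj_sum.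

Lemma osc_homogP p (x : osc_vect) : homog p x -> if p then x.1 = 0 else x.2 = 0.
Proof. by case: p => <-. Qed.

Lemma osc_brac_homog p q (x y : osc_vect) : homog p x -> homog q y ->
  homog (p (+) q (+) false) (osc_brac x y : osc_vect).
Proof.
move=> /osc_homogP + /osc_homogP.
case: x => [[a1 t1] [u1 v1]]; case: y => [[a2 t2] [u2 v2]].
by case: p; case: q => /= -[-> ->] [-> ->]; congr ((_, _), (_, _)); ring.
Qed.

Lemma osc_brac_anti p q (x y : osc_vect) : homog p x -> homog q y ->
  osc_brac y x = - ((-1) ^+ ((p (+) false) && (q (+) false)) *: osc_brac x y).
Proof.
move=> /osc_homogP + /osc_homogP.
case: x => [[a1 t1] [u1 v1]]; case: y => [[a2 t2] [u2 v2]].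
by case: p; case: q => /= -[-> ->] [-> ->]; congr ((_, _), (_, _));
  rewrite /= /GRing.scale /=; ring.
Qed.

Lemma osc_brac_jacobi p q r (x y z : osc_vect) :
  homog p x -> homog q y -> homog r z ->
    (-1) ^+ ((p (+) false) && (r (+) false)) *: osc_brac (osc_brac x y) z
  + (-1) ^+ ((q (+) false) && (p (+) false)) *: osc_brac (osc_brac y z) x
  + (-1) ^+ ((r (+) false) && (q (+) false)) *: osc_brac (osc_brac z x) y = 0.
Proof.
move=> /osc_homogP + /osc_homogP + /osc_homogP.
case: x => [[a1 t1] [u1 v1]]; case: y => [[a2 t2] [u2 v2]].
case: z => [[a3 t3] [u3 v3]].
by case: p; case: q; case: r => /= -[-> ->] [-> ->] [-> ->];
  congr ((_, _), (_, _)); rewrite /= /GRing.scale /=; ring.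
Qed.

Definition osc_lie : gradedLie F false :=
  @GradedLie F false osc_vect osc_brac
    osc_brac_homog osc_brac_anti osc_brac_jacobi.

Definition osc_Q : osc_lie := ((0, 0), (1, 1)).
Definition osc_a : osc_lie := ((1, 0), (0, 0)).

(** The odd component of [osc_a] is 0, so one odd letter kills the nest; each even letter multiplies
    the first odd coordinate by [alpha] and fixes the second. *)
Lemma osc_nest (u v : F) (l : seq (bool * osc_lie)) :
  all (fun w => w.2 == osc_proj w.1 osc_a) l ->
  nest (((0, 0), (u, v)) : osc_lie) l =
    (~~ has fst l)%:R *: (((0, 0), (alpha ^+ size l * u, v)) : osc_lie).
Proof.
elim: l u v => [|[p y] l IHl] u v /=.
  by rewrite scale1r expr0 mul1r.
case/andP=> /eqP -> /IHl IH.
transitivity (nest (((0, 0), ((~~ p)%:R * alpha * u, (~~ p)%:R * v)) : osc_lie) l).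
  rewrite -[LHS]/(nest (osc_brac ((0, 0), (u, v)) (osc_proj p osc_a) : osc_lie) l).
  by congr (nest _ l); case: p; congr ((_, _), (_, _)); rewrite /=; ring.
rewrite IH; case: p => /=; congr ((_, _), (_, _));
  rewrite /= /GRing.scale /= ?exprS; ring.
Qed.

(** Only the choice of all even components survives. Then all signs are trivial and the [n]!
    permutations give equal terms. *)
Lemma osc_split_bracket n (p : {ffun 'I_n -> bool}) i : (i <= n)%N ->
  split_bracket osc_Q (letters [tuple osc_a | _ < n] p) i =
    (p == [ffun=> false])%:R *: (n`!%:R *:
      (((0, alpha ^+ i + alpha ^+ (n - i)), (0, 0)) : osc_lie)).
Proof.
move=> lein; set t := letters _ p.
have t1 j : (tnth t j).1 = p j by rewrite tnth_mktuple addbF.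
have tP : all (fun w : bool * osc_lie => w.2 == osc_proj w.1 osc_a) t.
  by apply/all_tnthP => j; rewrite !tnth_mktuple addbF.
have tp : has fst t = ~~ (p == [ffun=> false]).
  apply/hasP/idP => [[x /tnthP[j ->]]|]; rewrite ?t1.
    by apply: contraTN => /eqP ->; rewrite ffunE.
  move=> np; have /existsP[j pj] : [exists j, p j].
    rewrite -[[exists j, p j]]negbK negb_exists; apply: contra np => /forallP np.
    by apply/eqP/ffunP => j; rewrite ffunE; apply/negbTE/np.
  by exists (tnth t j); rewrite ?mem_tnth ?t1.
transitivity (ssum fst t (fun y : seq (bool * osc_lie) => (-1) ^+ wpar fst (take i y) *:
  ((p == [ffun=> false])%:R *:
      (((0, alpha ^+ i + alpha ^+ (n - i)), (0, 0)) : osc_lie)))).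
  apply: eq_ssum => y yt; congr (_ *: _).
  have := tP; rewrite -(perm_all _ yt) -{1}(cat_take_drop i y) all_cat.
  case/andP=> yu yv; rewrite !osc_nest // size_drop size_takel.
    rewrite (perm_size yt) size_tuple.
    rewrite -[p == _]negbK -tp -(perm_has _ yt) -{3}(cat_take_drop i y) has_cat negb_or.
    case: (has _ _); case: (has _ _); congr ((_, _), (_, _));
      rewrite /= /GRing.scale /=; ring.
  by rewrite (perm_size yt) size_tuple.
have [p0|_] := eqVneq p [ffun=> false]; last first.
  by rewrite [RHS]scale0r /ssum big1 // => s _; rewrite scale0r !scaler0.
pose z : osc_lie := ((0, alpha ^+ i + alpha ^+ (n - i)), (0, 0)).
transitivity (\sum_(s : 'S_n) z); last first.
  by rewrite sumr_const scale1r scaler_nat; congr (_ *+ _); rewrite -card_Sn.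
apply: eq_bigr => s _; rewrite scale1r scalerA -signr_addb.
have par0 (y : seq (bool * osc_lie)) : ~~ has fst y -> wpar fst y = false.
  elim: y => [|w y IHy]; rewrite ?wpar_nil //= wpar_cons negb_or.
  by case/andP=> /negbTE -> /IHy.
rewrite par0 ?addbF.
  rewrite /koszul big1 ?scale1r // => j _; rewrite big1 // => k _.
  by rewrite /= !t1 p0 !ffunE.
apply/negP => /hasP[w /mem_take wt w1].
have : has fst t by rewrite -(perm_has _ (perm_word t s)); apply/hasP; exists w.
by rewrite tp p0 eqxx.
Qed.

Lemma osc_relation n (c : 'rV[F]_n.+1) : homogeneous_relations_n c ->
  \sum_(m < n.+1) row_lam c m / (m`!%:R * (n - m)`!%:R) *
    (alpha ^+ m + alpha ^+ (n - m)) = 0.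
Proof.
move=> homc; have homQ : homog (~~ false) osc_Q by [].
have := homc _ _ _ homQ [tuple osc_a | _ < n]; rewrite (bprodE homQ).
have splitE m : (m <= n)%N -> split_sum osc_Q [tuple osc_a | _ < n] m =
    n`!%:R *: (((0, alpha ^+ m + alpha ^+ (n - m)), (0, 0)) : osc_lie).
  move=> lemn; rewrite /split_sum (bigD1 [ffun=> false]) //= big1 ?addr0.
    by rewrite osc_split_bracket // eqxx scale1r.
  by move=> p np; rewrite osc_split_bracket // (negbTE np) scale0r.
move=> E; apply: (mulfI (natf_fact F n)); rewrite mulr0 mulr_sumr.
have {E} := congr1 (fun x : osc => x.1.2) E.
rewrite (big_morph (fun x : osc => x.1.2) (id1 := 0) (op1 := +%R)) //= => E.
rewrite -[RHS]E.
apply: eq_bigr => m _; rewrite splitE -1?ltnS //= /GRing.scale /= -/(row_lam c m). ring.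
Qed.

End Example.

(** * The homogeneous solution space and the general solution *)

Lemma homogeneous_relationsP (F : numFieldType) n (c : 'rV[F]_n.+1) :
  homogeneous_relations_n c <->
  forall m, (m <= n)%N -> row_lam c m = - row_lam c (n - m).
Proof.
split=> [homc|antic] => [m lemn|eps A Q homQ a]; last first.
  rewrite (bprod_symmetric (z := 0) a homQ) ?scale0r // => m lemn.
  by rewrite antic // addNr mul0rn.
(* The coefficients, as a polynomial in [alpha], of the relation obtained from the example. *)
pose g (k : nat) := (row_lam c k + row_lam c (n - k)) / (k`!%:R * (n - k)`!%:R).
have root_g x : (\poly_(k < n.+1) g k).[x] = 0.
  rewrite horner_poly -[RHS](osc_relation x homc).
  under [RHS]eq_bigr => k _ do rewrite mulrDr.
  rewrite big_split /= [X in _ + X](reindex_inj rev_ord_inj) -big_split /=.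
  apply: eq_bigr => k _; have lekn : (k <= n)%N by rewrite -ltnS.
  by rewrite subSS subKn // [(n - k)`!%:R * _]mulrC -mulrDl -mulrDl.
(* The relation holds for every [alpha]; the [n.+1] distinct roots 0, ..., n already exceed the
   degree bound [n]. *)
pose rs : seq F := [seq i%:R | i <- iota 0 n.+1].
have g0 : \poly_(k < n.+1) g k = 0.
  have root_rs : all (root (\poly_(k < n.+1) g k)) rs.
    by apply/allP => x _; rewrite rootE root_g.
  have uniq_rs : uniq rs.
    by rewrite map_inj_uniq ?iota_uniq //; exact: Num.Theory.mulrIn (oner_neq0 _).
  apply/eqP/negPn/negP => /max_poly_roots/(_ root_rs uniq_rs).
  by rewrite size_map size_iota ltnNge size_poly.
have := congr1 (fun P : {poly F} => P`_m) g0; rewrite coef0 coef_poly ltnS lemn.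
move/eqP; rewrite /g mulf_eq0 invr_eq0 mulf_eq0 !(negbTE (natf_fact F _)) !orbF.
by rewrite addr_eq0 => /eqP.
Qed.

Lemma homogeneous_space (F : numFieldType) n :
  let X := [tuple hom_basis F n m | m < (n + 1) %/ 2] in
  [/\ forall v : 'rV[F]_n.+1, v \in <<X>>%VS <-> homogeneous_relations_n v,
      \dim <<X>> = ((n + 1) %/ 2)%N
    & basis_of <<X>> X].
Proof.
move=> X; have XE (m : 'I_((n + 1) %/ 2)) : X`_m = hom_basis F n m.
  by rewrite nth_mktuple.
have lt_half (m : 'I_((n + 1) %/ 2)) : (m < n - m)%N.
  by have := ltn_ord m; lia.
have freeX : free X.
  (* As all labels lie strictly below n/2, [row_lam] at [m] sees only the first half of each basis
     vector and returns [mu m]. *)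
  apply/freeP => mu mu0 m; have := congr1 (fun v => row_lam v m) mu0.
  rewrite row_lam_sum [RHS]big1 => [<-|k _]; last by rewrite mxE !mul0r.
  have ltm := lt_half m; rewrite (bigD1 m) //= big1 ?addr0 => [|k nek].
    by rewrite XE row_lam_hom_basis ?eqxx ?(ltn_eqF ltm) ?subr0 ?mulr1 //; lia.
  have ltk := lt_half k; rewrite XE row_lam_hom_basis; try lia.
  rewrite val_eqE eq_sym (negbTE nek) ltn_eqF ?subr0 ?mulr0 //.
  by have := ltn_ord k; have := ltn_ord m; lia.
split; [|by rewrite (eqP freeX) size_tuple|by rewrite /basis_of eqxx].
move=> v; split=> [/coord_span ->|/homogeneous_relationsP anti].
  apply/homogeneous_relationsP => m lemn; rewrite !row_lam_sum -sumrN.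
  apply: eq_bigr => k _; have ltk := lt_half k; rewrite -mulrN XE.
  rewrite !row_lam_hom_basis ?leq_subr //; try lia.
  rewrite opprB; congr (_ * (_%:R - _%:R)); lia.
(* Pairing [m] with [n - m] in the dual expansion of [v] groups the tuples [bern_shift] into the
   differences that form the basis. *)
rewrite (sum_row_lam v) (sum_antisym (fun m => \row_k bern_shift F m k)) //.
apply: memv_suml => m _; have ltm := lt_half m.
rewrite -hom_basisE; last by lia.
by rewrite memvZ // -XE memv_span // mem_nth // size_tuple.
Qed.

Lemma square_relations_sol (F : numFieldType) (c : coefs F) :
  (forall n (k : 'I_n.+1), c n 0 k = bernoulli F k + (k == 1 :> nat)%N%:R) ->
  square_relations c.
Proof.
move=> cE eps A Q homQ n a; rewrite /bprod (bprod_symmetric (z := 1) a homQ).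
  by rewrite scale1r.
move=> m lemn; pose d (k : nat) := bernoulli F k + (k == 1)%N%:R.
by rewrite !(row_lamE (d := d)) ?leq_subr // !lam_sol mulr2n.
Qed.

Lemma bprod_nD (F : fieldType) (eps : bool) (A : gradedVect F) n
    (c d : 'rV[F]_n.+1) (Phi Phi' : bullet A) (a : n.-tuple A) :
  bprod_n eps (c + d) Phi Phi' a = bprod_n eps c Phi Phi' a + bprod_n eps d Phi Phi' a.
Proof.
rewrite /bprod_n -big_split; apply: eq_bigr => k _ /=.
by rewrite mxE mulrDl scalerDl.
Qed.

Theorem theorem4p3 (R : realType) :
  (forall c : coefs R[i],
     square_relations c <->
     exists2 cH : coefs R[i], homogeneous_relations cH &
       forall (n : nat) (k : 'I_n.+1),
         c n 0 k = bernoulli R[i] k + (k == 1 :> nat)%N%:R + cH n 0 k)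
  /\
  (forall n : nat, exists S : {vspace 'rV[R[i]]_n.+1},
     [/\ forall v : 'rV[R[i]]_n.+1, v \in S <-> homogeneous_relations_n v,
         \dim S = ((n + 1) %/ 2)%N
       & basis_of S [tuple hom_basis R[i] n m | m < ((n + 1) %/ 2)%N]]).
Proof.
split=> [c|n]; last first.
  exists <<[tuple hom_basis R[i] n m | m < (n + 1) %/ 2]>>%VS.
  exact: homogeneous_space.
pose c0 : coefs R[i] := fun n =>
  \row_(k < n.+1) (bernoulli R[i] k + (k == 1 :> nat)%N%:R).
have c0E n (k : 'I_n.+1) : c0 n 0 k = bernoulli R[i] k + (k == 1 :> nat)%N%:R.
  by rewrite mxE.
have c0sq := square_relations_sol c0E.
split=> [csq|[cH homcH cE] eps A Q homQ n a].
  (* The bracket product is additive in the coefficients, so the difference from the particular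
     solution [c0] is homogeneous. *)
  exists (fun n => c n - c0 n) => [eps A Q homQ n a|n k]; last first.
    by rewrite -c0E [(c n - c0 n) 0 k]mxE [(- c0 n) 0 k]mxE subrKC.
  apply: (addrI (bprod eps c0 (derived Q) (derived Q) a)).
  rewrite addr0 /bprod -bprod_nD subrKC.
  exact: etrans (csq _ _ _ homQ _ _) (esym (c0sq _ _ _ homQ _ _)).
have -> : bprod eps c (derived Q) (derived Q) a =
    bprod_n eps (c0 n + cH n) (derived Q) (derived Q) a.
  by congr bprod_n; apply/rowP => k; rewrite cE -c0E [RHS]mxE.
rewrite bprod_nD -[RHS]addr0.
by congr (_ + _); [apply: c0sq|apply: homcH].
Qed.
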